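(* Let $n \ge 1$ be an integer, let $\xi$ be a random variable taking values in $\mathbb{R}^{n}$ with distribution $\mathbb{P}$, and let $N$ be an integer with $N \ge n$. Let $\xi^{(1)},\dots,\xi^{(N)},\xi^{(N+1)} \in \mathbb{R}^{n}$ be $N+1$ independent and identically distributed samples of $\xi$, with joint law $\mathbb{P}^{N+1}$. Let $\mu_N$ and $\Sigma_N$ be the empirical mean and the unbiased empirical covariance of the first $N$ samples, and assume that $\Sigma_N$ is nonsingular (almost surely). Then for all real $\lambda > 0$, $$ \mathbb{P}^{N+1}\left( (\xi^{(N+1)} - \mu_N)^\top \Sigma_N^{-1} (\xi^{(N+1)} - \mu_N) \ge \lambda^2 \right) \le \min\left\{ 1, \ \frac{1}{N+1} \left\lfloor \frac{n (N+1)(N^2 - 1 + N\lambda^2)}{N^2 \lambda^2} \right\rfloor \right\}. $$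
   Context: For samples $\xi^{(1)},\dots,\xi^{(N)} \in \mathbb{R}^n$, the empirical mean is $\mu_N := \frac{1}{N}\sum_{i=1}^{N}\xi^{(i)}$, and the unbiased empirical covariance is $\Sigma_N := \frac{1}{N-1}\sum_{i=1}^{N}(\xi^{(i)}-\mu_N)(\xi^{(i)}-\mu_N)^\top \in \mathbb{R}^{n\times n}$. Here $\lfloor\cdot\rfloor$ denotes the floor function. *)

(* Defs.v *)
From HB Require Import structures.
From mathcomp Require Import all_boot all_order all_algebra.
From mathcomp Require Import all_classical all_reals all_analysis.
Import numFieldNormedType.Exports.
Import Order.TTheory GRing.Theory Num.Theory.

Set Implicit Arguments.
Unset Strict Implicit.
Unset Printing Implicit Defensive.

Local Open Scope classical_set_scope.
Local Open Scope ring_scope.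

(* Borel sigma-algebra on real matrices; R^n is rendered as 'cV[R]_n. *)
HB.instance Definition _ (R : realType) (m n : nat) :=
  Measurable.copy 'M[R]_(m, n) (g_sigma_algebraType (@open 'M[R]_(m, n))).

(* X and Y may live on different probability spaces. *)
Definition same_distribution d d0 d' (T : measurableType d)
    (T0 : measurableType d0) (T' : measurableType d') (R : realType)
    (P : probability T R) (P0 : probability T0 R)
    (X : {RV P >-> T'}) (Y : {RV P0 >-> T'}) : Prop :=
  forall A : set T', measurable A -> distribution P X A = distribution P0 Y A.

Definition mutually_independent d d' (T : measurableType d)
    (T' : measurableType d') (R : realType) (P : probability T R)
    (I : finType) (X : I -> {RV P >-> T'}) : Prop :=
  forall (J : {set I}) (A : I -> set T'),
    (forall i, i \in J -> measurable (A i)) ->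
    P (\bigcap_(i in [set` J]) (X i @^-1` A i))
      = (\prod_(i in J) P (X i @^-1` A i))%E.

Section empirical.
Variables (R : realType) (n N : nat).
Implicit Type x : 'I_N -> 'cV[R]_n.

Definition empirical_mean x : 'cV[R]_n := N%:R^-1 *: \sum_(i < N) x i.

Definition empirical_covariance x : 'M[R]_n :=
  (N%:R - 1)^-1 *:
    \sum_(i < N) (x i - empirical_mean x) *m (x i - empirical_mean x)^T.

End empirical.

(* The quadratic form (z - mu)^T S^-1 (z - mu), as the entry of a 1 x 1 matrix;
   invmx S is the inverse only when S is nonsingular (otherwise it is S). *)
Definition mahalanobis_sq (R : realType) (n : nat) (S : 'M[R]_n)
    (mu z : 'cV[R]_n) : R :=
  ((z - mu)^T *m invmx S *m (z - mu)) ord0 ord0.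

(* The first N of N + 1 samples, at the outcome w. *)
Definition first_samples (T V : Type) (N : nat) (X : 'I_N.+1 -> T -> V)
    (w : T) : 'I_N -> V :=
  fun i => X (widen_ord (leqnSn N) i) w.

(* Main.v *)
Require Import Defs.
From mathcomp Require Import all_boot all_order all_algebra.
From mathcomp Require Import all_classical all_reals all_analysis.
From mathcomp Require Import perm measurable_realfun ring lra.
Import numFieldNormedType.Exports.
Import Order.TTheory GRing.Theory Num.Theory.

(* Let S be the scatter matrix of all N + 1 samples about their mean m.  The
   numbers T_i = (x_i - m)^T S^-1 (x_i - m) are nonnegative and sum to
   tr (S^-1 S) = n, so at most floor (n / t) of them are >= t.  The samples are
   exchangeable, so each index is equally likely to be among those:
   P (T_{N+1} >= t) <= floor (n / t) / (N + 1).  By the Sherman-Morrison formula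
   T_{N+1} is an increasing function of the Mahalanobis distance of x_{N+1} to
   the first N samples, and distance lambda corresponds to
   t = N^2 lambda^2 / ((N + 1) (N^2 - 1 + N lambda^2)). *)

Local Open Scope classical_set_scope.
Local Open Scope ring_scope.

(** * Rank-one update of an inverse matrix *)

Lemma sherman_morrison (F : fieldType) (n : nat) (S : 'M[F]_n) (v : 'cV[F]_n)
    (c : F) (q := (v^T *m invmx S *m v) ord0 ord0) :
  S \in unitmx -> 1 + c * q != 0 ->
  S + c *: (v *m v^T) \in unitmx /\
  (v^T *m invmx (S + c *: (v *m v^T)) *m v) ord0 ord0 = q / (1 + c * q).
Proof.
move=> uS nz; set A := S + _.
have qE : v^T *m invmx S *m v = q%:M by rewrite [LHS]mx11_scalar.
have vq : v *m v^T *m invmx S *m v = q *: v.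
  by rewrite -!mulmxA (mulmxA v^T) qE mul_mx_scalar.
(* The Sherman-Morrison candidate for the inverse of [A]. The product [A *m B] collapses because
   [v^T *m invmx S *m v] is the scalar [q]; for square matrices a right inverse suffices. *)
pose B := invmx S - (c / (1 + c * q)) *: (invmx S *m v *m (v^T *m invmx S)).
have AB : A *m B = 1%:M.
  rewrite mulmxDl !mulmxBr mulmxV // -!scalemxAr -!scalemxAl !mulmxA.
  rewrite mulmxV // mul1mx.
  have -> : v *m v^T *m invmx S *m v *m v^T *m invmx S =
            q *: (v *m v^T *m invmx S).
    by rewrite vq -!scalemxAl.
  set W := v *m v^T *m invmx S.
  rewrite scalerA -addrA -[RHS]addr0; congr (_ + _).
  rewrite scalerA -scalerBl -scaleNr -scalerDl -[RHS](scale0r W).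
  by congr (_ *: _); field.
have [uA _] := mulmx1_unit AB; split=> //.
have -> : invmx A = B by rewrite -[LHS]mulmx1 -AB mulKmx.
rewrite mulmxBr mulmxBl -scalemxAr -scalemxAl !mulmxA qE.
rewrite mul_scalar_mx -!scalemxAl qE.
by rewrite !mxE eqxx !mulr1n; field.
Qed.

(** * Algebra of scatter matrices and Mahalanobis distances *)

Section scatter.
Context (R : realType) (n : nat).
Set Implicit Arguments.
Unset Strict Implicit.

(** Left unnormalized so that adding one sample is a pure rank-one update. *)
Definition scatter (N : nat) (x : 'I_N -> 'cV[R]_n) : 'M[R]_n :=
  \sum_(i < N) (x i - empirical_mean x) *m (x i - empirical_mean x)^T.

(** The trace is linear in the rank-one matrix, so a sum over samples can be moved inside, where it
    rebuilds the scatter matrix. *)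
Lemma mahalanobis_sqE (S : 'M[R]_n) (mu z : 'cV[R]_n) :
  mahalanobis_sq S mu z = \tr (invmx S *m ((z - mu) *m (z - mu)^T)).
Proof.
by rewrite /mahalanobis_sq -trace_mx11 -mulmxA mxtrace_mulC -mulmxA.
Qed.

Lemma sum_mahalanobis_sq (N : nat) (x : 'I_N -> 'cV[R]_n) :
  scatter x \in unitmx ->
  \sum_(i < N) mahalanobis_sq (scatter x) (empirical_mean x) (x i) = n%:R.
Proof.
move=> uS; under eq_bigr do rewrite mahalanobis_sqE.
rewrite -raddf_sum -mulmx_sumr -/(scatter x) mulVmx //; exact: mxtrace1.
Qed.

Lemma scatter_tr (N : nat) (x : 'I_N -> 'cV[R]_n) : (scatter x)^T = scatter x.
Proof.
by rewrite [LHS]raddf_sum; apply: eq_bigr => i _; rewrite /= trmx_mul trmxK.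
Qed.

(** With y = S^-1 (z - mu), symmetry of S turns the form into y^T S y, a sum of the squares (u_i^T
    y)^2 over the centered samples u_i. *)
Lemma mahalanobis_sq_ge0 (N : nat) (x : 'I_N -> 'cV[R]_n) (mu z : 'cV[R]_n) :
  scatter x \in unitmx -> 0 <= mahalanobis_sq (scatter x) mu z.
Proof.
move=> uS; set S := scatter x.
pose y := invmx S *m (z - mu).
have -> : mahalanobis_sq S mu z = (y^T *m S *m y) ord0 ord0.
  rewrite /mahalanobis_sq /y trmx_mul trmx_inv scatter_tr.
  by rewrite -!mulmxA mulKVmx.
move: y => y; rewrite /S /scatter mulmx_sumr mulmx_suml summxE sumr_ge0 // => i _.
set u := x i - _; have -> : y^T *m (u *m u^T) *m y = (u^T *m y)^T *m (u^T *m y).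
  by rewrite trmx_mul trmxK !mulmxA.
by rewrite mxE sumr_ge0 // => k _; rewrite mxE -expr2 sqr_ge0.
Qed.

Lemma empirical_mean_perm (N : nat) (x : 'I_N -> 'cV[R]_n) (s : 'S_N) :
  empirical_mean (x \o s) = empirical_mean x.
Proof.
by rewrite /empirical_mean [in RHS](reindex_inj (@perm_inj _ s)).
Qed.

Lemma scatter_perm (N : nat) (x : 'I_N -> 'cV[R]_n) (s : 'S_N) :
  scatter (x \o s) = scatter x.
Proof.
by rewrite /scatter empirical_mean_perm [in RHS](reindex_inj (@perm_inj _ s)).
Qed.

Lemma empirical_mean_recr (N : nat) (x : 'I_N.+1 -> 'cV[R]_n)
    (mu := empirical_mean (x \o widen_ord (leqnSn N))) :
  (0 < N)%N ->
  empirical_mean x = mu + N.+1%:R^-1 *: (x ord_max - mu).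
Proof.
move=> N0; have N0' : N%:R != 0 :> R by rewrite pnatr_eq0 -lt0n.
have N1 : N.+1%:R != 0 :> R by rewrite pnatr_eq0.
rewrite {1}/empirical_mean big_ord_recr /=.
have -> : \sum_(i < N) x (widen_ord (leqnSn N) i) = N%:R *: mu.
  by rewrite /mu /empirical_mean scalerA divff // scale1r.
move: mu => mu; apply/matrixP => i j; rewrite !mxE -natr1.
by field; rewrite natr1.
Qed.

(** Parallel axis theorem: the cross terms vanish because deviations from the mean sum to zero. *)
Lemma scatter_shift (N : nat) (x : 'I_N -> 'cV[R]_n) (c : 'cV[R]_n) :
  (0 < N)%N ->
  \sum_(i < N) (x i - c) *m (x i - c)^T =
  scatter x + N%:R *: ((empirical_mean x - c) *m (empirical_mean x - c)^T).
Proof.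
move=> N0; set mu := empirical_mean x; set v := mu - c.
have sum0 : \sum_(i < N) (x i - mu) = 0.
  rewrite sumrB sumr_const card_ord /mu /empirical_mean -scaler_nat scalerA.
  by rewrite divff ?scale1r ?subrr // pnatr_eq0 -lt0n.
have E i : (x i - c) *m (x i - c)^T = (x i - mu) *m (x i - mu)^T
    + (x i - mu) *m v^T + v *m (x i - mu)^T + v *m v^T.
  have -> : x i - c = (x i - mu) + v by rewrite /v addrA subrK.
  by rewrite [(_ + v)^T]raddfD mulmxDl !mulmxDr !addrA.
under eq_bigr do rewrite E.
rewrite !big_split /= -mulmx_suml -mulmx_sumr -raddf_sum sum0.
by rewrite raddf0 mul0mx mulmx0 !addr0 sumr_const card_ord scaler_nat.
Qed.

(** Shift the first N samples to the new mean m. They contribute N / (N + 1)^2 times v v^T, since mu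
    - m = - v / (N + 1), and the new sample contributes N^2 / (N + 1)^2 times v v^T; the two add up
    to N / (N + 1). *)
Lemma scatter_recr (N : nat) (x : 'I_N.+1 -> 'cV[R]_n)
    (y := x \o widen_ord (leqnSn N)) (v := x ord_max - empirical_mean y) :
  (0 < N)%N ->
  scatter x = scatter y + (N%:R / N.+1%:R) *: (v *m v^T).
Proof.
move=> N0; have N1 : N%:R + 1 != 0 :> R by rewrite natr1 pnatr_eq0.
rewrite {1}/scatter big_ord_recr /= (scatter_shift y _ N0) -addrA.
rewrite (empirical_mean_recr x N0) -/y -/v.
have -> : x ord_max - (empirical_mean y + N.+1%:R^-1 *: v) =
          (N%:R / N.+1%:R) *: v.
  rewrite opprD addrA -/v -{1}(scale1r v) -scalerBl -natr1.
  by congr (_ *: _); field.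
rewrite opprD addNKr -scaleNr ![(_ *: v)^T]linearZ /=.
rewrite -!scalemxAl -!scalemxAr !scalerA -scalerDl -natr1.
by congr (_ + _ *: _); field.
Qed.

(** Sherman-Morrison with c = N / (N + 1), where q >= 0 keeps 1 + c q positive. The squared factor
    appears because the last sample minus the new mean is c v. *)
Lemma mahalanobis_sq_recr (N : nat) (x : 'I_N.+1 -> 'cV[R]_n)
    (y := x \o widen_ord (leqnSn N))
    (q := mahalanobis_sq (scatter y) (empirical_mean y) (x ord_max)) :
  (0 < N)%N -> scatter y \in unitmx ->
  scatter x \in unitmx /\
  mahalanobis_sq (scatter x) (empirical_mean x) (x ord_max) =
    (N%:R / N.+1%:R) ^+ 2 * (q / (1 + N%:R / N.+1%:R * q)).
Proof.
move=> N0 uy; have N1 : N%:R + 1 != 0 :> R by rewrite natr1 pnatr_eq0.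
have q0 : 0 <= q by exact: mahalanobis_sq_ge0.
have nz : 1 + N%:R / N.+1%:R * q != 0.
  by rewrite gt_eqF // ltr_wpDr // mulr_ge0 // divr_ge0.
have [ux E] := @sherman_morrison _ _ _ _ (N%:R / N.+1%:R) uy nz.
rewrite (scatter_recr x N0) -/y; split=> //.
rewrite /mahalanobis_sq (empirical_mean_recr x N0) -/y.
set v := x ord_max - empirical_mean y.
have -> : x ord_max - (empirical_mean y + N.+1%:R^-1 *: v) =
          (N%:R / N.+1%:R) *: v.
  rewrite opprD addrA -/v -{1}(scale1r v) -scalerBl -natr1.
  by congr (_ *: _); field.
rewrite [(_ *: v)^T]linearZ /= -!scalemxAl -scalemxAr scalerA mxE E.
by rewrite expr2.
Qed.

(** Nonsingularity excludes the degenerate sizes: the covariance is an empty sum for N = 0 and has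
    the factor 0^-1 = 0 for N = 1, and the zero matrix is singular when n > 0. *)
Lemma empirical_covariance_unit (N : nat) (y : 'I_N -> 'cV[R]_n) :
  (0 < n)%N -> empirical_covariance y \in unitmx ->
  [/\ (1 < N)%N, scatter y \in unitmx &
    forall mu z, mahalanobis_sq (empirical_covariance y) mu z =
      (N%:R - 1) * mahalanobis_sq (scatter y) mu z].
Proof.
move=> n0; rewrite /empirical_covariance -/(scatter y) => uS.
have u0 : (0 : 'M[R]_n) \in unitmx = false.
  by rewrite -row_free_unit /row_free mxrank0 eq_sym gtn_eqF.
have a0 : (N%:R - 1)^-1 != 0 :> R.
  by apply: contraTneq uS => ->; rewrite scale0r u0.
have uy : scatter y \in unitmx.
  by move: uS; rewrite !unitmxE detZ unitrM => /andP[].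
split=> //.
  case: N y a0 uS uy => [|[|N]] y a0 uS uy //.
    by move: uy; rewrite /scatter big_ord0 u0.
  by move: a0; rewrite subrr invr0 eqxx.
move=> mu z; rewrite /mahalanobis_sq invmxZ // invrK.
by rewrite -scalemxAr -scalemxAl mxE.
Qed.

Lemma mahalanobis_sq_full_sample (N : nat) (x : 'I_N.+1 -> 'cV[R]_n)
    (y := x \o widen_ord (leqnSn N)) (lambda : R) :
  (0 < n)%N -> 0 < lambda -> empirical_covariance y \in unitmx ->
  lambda ^+ 2 <=
    mahalanobis_sq (empirical_covariance y) (empirical_mean y) (x ord_max) ->
  scatter x \in unitmx /\
  N%:R ^+ 2 * lambda ^+ 2
    / (N.+1%:R * (N%:R ^+ 2 - 1 + N%:R * lambda ^+ 2)) <=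
  mahalanobis_sq (scatter x) (empirical_mean x) (x ord_max).
Proof.
move=> n0 l0 uS; have [N1 uy ->] := empirical_covariance_unit n0 uS.
have [ux ->] := mahalanobis_sq_recr (ltnW N1) uy.
rewrite -/y; have := mahalanobis_sq_ge0 (empirical_mean y) (x ord_max) uy.
set q := mahalanobis_sq _ _ _ => q0 le_lq; split=> //.
have l2 : 0 < lambda ^+ 2 by rewrite exprn_gt0.
have N1' : 1 < N%:R :> R by rewrite ltr1n.
move: (lambda ^+ 2) l2 le_lq => l l2 le_lq; rewrite -natr1.
move: (N%:R : R) N1' le_lq => a a1 le_lq.
have d1 : 0 < a ^+ 2 - 1 + a * l by nra.
have d2 : 0 < 1 + a / (a + 1) * q.
  by rewrite ltr_wpDr // mulr_ge0 // divr_ge0 //; lra.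
have d3 : 0 < a + 1 + a * q by nra.
have -> : (a / (a + 1)) ^+ 2 * (q / (1 + a / (a + 1) * q)) =
          a ^+ 2 * q / ((a + 1) * (a + 1 + a * q)).
  by field; apply/andP; split; rewrite gt_eqF //; lra.
rewrite ler_pdivlMr ?mulr_gt0 //; last lra.
rewrite mulrAC ler_pdivrMr ?mulr_gt0 //; last lra.
(* After cancelling a q l, this is [le_lq], that is l <= (a - 1) q, multiplied by a + 1. *)
have key : l * (a + 1 + a * q) <= q * (a ^+ 2 - 1 + a * l) by nra.
have -> : a ^+ 2 * l * ((a + 1) * (a + 1 + a * q)) =
          (a ^+ 2 * (a + 1)) * (l * (a + 1 + a * q)) by ring.
have -> : a ^+ 2 * q * ((a + 1) * (a ^+ 2 - 1 + a * l)) =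
          (a ^+ 2 * (a + 1)) * (q * (a ^+ 2 - 1 + a * l)) by ring.
by rewrite ler_wpM2l // mulr_ge0 ?sqr_ge0 //; lra.
Qed.

(** Markov's inequality for the counting measure; the floor costs nothing because the count is an
    integer. *)
Lemma card_mahalanobis_sq_ge (N : nat) (x : 'I_N -> 'cV[R]_n) (t : R) :
  scatter x \in unitmx -> 0 < t ->
  (#|[set i | t <= mahalanobis_sq (scatter x) (empirical_mean x) (x i)]%SET|
     : int) <= Num.floor (n%:R / t).
Proof.
move=> ux t0; rewrite floor_ge_int ler_pdivlMr //.
rewrite -(sum_mahalanobis_sq ux) -pmulrn -sum1_card natr_sum mulr_suml.
rewrite big_mkcond /= ler_sum // => i _.
by rewrite inE; case: ifP => [le_t|_]; rewrite ?mul1r // mahalanobis_sq_ge0.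
Qed.

End scatter.

(** * Measurability of matrix-valued functions *)

Section measurable_matrix.
Context d (T : measurableType d) (R : realType).
Set Implicit Arguments.
Unset Strict Implicit.

(** Open rays generate the Borel sets of the line, and their preimages are open because coordinates
    are continuous. *)
Lemma measurable_coord m n (i : 'I_m) (j : 'I_n) :
  measurable_fun setT (fun A : 'M[R]_(m, n) => A i j).
Proof.
apply: (measurability _ (RGenOInfty.measurableE R)) => //.
move=> _ [_ [x ->] <-]; rewrite setTI; apply: sub_sigma_algebra.
apply: open_comp; last exact: interval_open.
by move=> A _; exact: coord_continuous.
Qed.

(** Stated entry by entry, so that matrix operations reduce to arithmetic of measurable real
    functions. *)
Definition measurable_mx m n (A : T -> 'M[R]_(m, n)) :=
  forall i j, measurable_fun setT (fun w => A w i j).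

Lemma measurable_mxB m n (A B : T -> 'M[R]_(m, n)) :
  measurable_mx A -> measurable_mx B -> measurable_mx (fun w => A w - B w).
Proof.
move=> mA mB i j; under eq_fun do rewrite !mxE.
exact: measurable_funB.
Qed.

Lemma measurable_mxZ m n (c : R) (A : T -> 'M[R]_(m, n)) :
  measurable_mx A -> measurable_mx (fun w => c *: A w).
Proof.
move=> mA i j; under eq_fun do rewrite !mxE.
exact: measurable_funM.
Qed.

Lemma measurable_mx_sum m n k (A : 'I_k -> T -> 'M[R]_(m, n)) :
  (forall l, measurable_mx (A l)) -> measurable_mx (fun w => \sum_(l < k) A l w).
Proof.
move=> mA i j; under eq_fun do rewrite summxE.
by apply: measurable_sum => l; exact: mA.
Qed.

Lemma measurable_trmx m n (A : T -> 'M[R]_(m, n)) :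
  measurable_mx A -> measurable_mx (fun w => (A w)^T).
Proof. by move=> mA i j; under eq_fun do rewrite mxE; exact: mA. Qed.

Lemma measurable_mulmx m n p (A : T -> 'M[R]_(m, n)) (B : T -> 'M[R]_(n, p)) :
  measurable_mx A -> measurable_mx B -> measurable_mx (fun w => A w *m B w).
Proof.
move=> mA mB i j; under eq_fun do rewrite mxE.
by apply: measurable_sum => l; exact: measurable_funM.
Qed.

Lemma measurable_det n (A : T -> 'M[R]_n) :
  measurable_mx A -> measurable_fun setT (fun w => \det (A w)).
Proof.
move=> mA; apply: measurable_sum => s; apply: measurable_funM => //.
by apply: measurable_prod => i _; exact: mA.
Qed.

(** Inversion is continuous only away from 0, so the line is split into the open set of nonzero
    reals and a single point. *)
Lemma measurable_invr : measurable_fun setT (@GRing.inv R).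
Proof.
have open0 : open [set~ (0 : R)] by apply: closed_openC; exact: closed_eq.
rewrite -(setvU [set (0 : R)]).
apply/measurable_funU => //; first exact: open_measurable.
split; last exact: measurable_fun_set1.
apply: open_continuous_measurable_fun => // x.
by rewrite inE => /eqP x0; exact: inv_continuous.
Qed.

Lemma measurable_unitmx n (A : T -> 'M[R]_n) :
  measurable_mx A -> measurable_fun setT (fun w => A w \in unitmx).
Proof.
move=> mA; under eq_fun do rewrite unitmxE unitfE.
apply: measurable_neg.
by apply: measurable_fun_eqr; [exact: measurable_det|exact: measurable_cst].
Qed.

Lemma measurable_invmx n (A : T -> 'M[R]_n) :
  measurable_mx A -> measurable_mx (fun w => invmx (A w)).
Proof.
move=> mA i j; rewrite /invmx.
under eq_fun => w do rewrite (fun_if (fun B : 'M[R]_n => B i j)) !mxE.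
(* Where [A w] is nonsingular the entry is a cofactor divided by the determinant; elsewhere [invmx]
   returns [A w] itself. *)
apply: measurable_fun_ifT; [exact: measurable_unitmx| |exact: mA].
apply: measurable_funM.
  by apply: measurableT_comp; [exact: measurable_invr|exact: measurable_det].
apply: measurable_funM => //; apply: measurable_det => k l.
by under eq_fun do rewrite !mxE; exact: mA.
Qed.

Context (n N : nat) (x : T -> 'I_N -> 'cV[R]_n)
  (mx : forall i, measurable_mx (x ^~ i)).

Lemma measurable_empirical_mean : measurable_mx (fun w => empirical_mean (x w)).
Proof. by apply: measurable_mxZ; apply: measurable_mx_sum. Qed.

Lemma measurable_scatter : measurable_mx (fun w => scatter (x w)).
Proof.
apply: measurable_mx_sum => i.
have mB := measurable_mxB (mx i) measurable_empirical_mean.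
by apply: measurable_mulmx => //; exact: measurable_trmx.
Qed.

Lemma measurable_empirical_covariance :
  measurable_mx (fun w => empirical_covariance (x w)).
Proof. by apply: measurable_mxZ; exact: measurable_scatter. Qed.

Lemma measurable_mahalanobis_sq (S : T -> 'M[R]_n) (mu z : T -> 'cV[R]_n) :
  measurable_mx S -> measurable_mx mu -> measurable_mx z ->
  measurable_fun setT (fun w => mahalanobis_sq (S w) (mu w) (z w)).
Proof.
move=> mS mmu mz; have mB := measurable_mxB mz mmu.
apply: (measurable_mulmx _ mB); apply: measurable_mulmx.
  exact: measurable_trmx.
exact: measurable_invmx.
Qed.

End measurable_matrix.

(** * Laws of finite families and exchangeability *)

Section cylinders.
Context {d d'} {T : measurableType d} {V : measurableType d'} {R : realType}.
Context {I : finType} (P : probability T R).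
Set Implicit Arguments.
Unset Strict Implicit.

(** Measurable rectangles: a pi-system generating the product sigma-algebra on [I -> V]. *)
Definition cylinders : set (set (I -> V)) :=
  [set [set x | forall i, A i (x i)] | A in
    [set A : I -> set V | forall i, measurable (A i)]].

Lemma setI_closed_cylinders : setI_closed cylinders.
Proof.
move=> _ _ [A mA <-] [B mB <-]; exists (fun i => A i `&` B i).
  by move=> i; apply: measurableI; [exact: mA|exact: mB].
apply/seteqP; split=> x /=; first by move=> AB; split=> i; case: (AB i).
by case=> Ax Bx i; split.
Qed.

Lemma measurable_eval (i : I) :
  measurable_fun setT (fun x : g_sigma_algebraType cylinders => x i).
Proof.
move=> _ A mA; rewrite setTI; apply: sub_sigma_algebra.
exists (fun j => if j == i then A else setT); first by move=> j; case: ifP.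
apply/seteqP; split=> x /=; first by move/(_ i); rewrite eqxx.
by move=> Ax j; case: eqP => [->|].
Qed.

Lemma measurable_path (Y : I -> {RV P >-> V}) :
  measurable_fun setT (fun w => (Y ^~ w) : g_sigma_algebraType cylinders).
Proof.
apply: (@measurability _ _ _ (g_sigma_algebraType cylinders) _ _ cylinders)
  => [|_ [_ [A mA <-] <-]] //.
rewrite setTI [X in measurable X](_ : _ = \bigcap_(i in [set: I]) (Y i @^-1` A i)).
  apply: fin_bigcap_measurable => // i _.
  by rewrite -[_ @^-1` _]setTI; apply: measurable_funP => //; exact: mA.
by apply/seteqP; split=> w /= h i; [move=> _; exact: h|exact: h].
Qed.

(** Uniqueness of measures on a pi-system, applied to the two pushforwards of [P] to the path
    space. *)
Lemma eq_law (Y Z : I -> {RV P >-> V}) :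
  (forall A : I -> set V, (forall i, measurable (A i)) ->
     P [set w | forall i, A i (Y i w)] = P [set w | forall i, A i (Z i w)]) ->
  forall B, <<s cylinders >> B ->
    P [set w | B (fun i => Y i w)] = P [set w | B (fun i => Z i w)].
Proof.
move=> YZ B mB.
pose C := g_sigma_algebraType cylinders.
have mY := measurable_path Y; have mZ := measurable_path Z.
pose fY : {mfun T >-> C} := mfun_Sub (mem_set mY).
pose fZ : {mfun T >-> C} := mfun_Sub (mem_set mZ).
apply: (@measure_unique _ R C cylinders (fun=> setT) erefl
  setI_closed_cylinders _ _ (pushforward P fY) (pushforward P fZ)) => //.
- by move=> _; exists (fun=> setT) => //; apply/seteqP; split.
- by rewrite bigcup_const.
- by move=> _ [A mA <-]; exact: YZ.
- by move=> _; change (P setT < +oo)%E; rewrite probability_setT ltry.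
Qed.

(** On a rectangle independence gives a product of marginal probabilities, and equal marginals make
    it insensitive to the order of the factors. *)
Lemma iid_exchangeable (X : I -> {RV P >-> V}) (s : {perm I}) :
  mutually_independent X ->
  (forall i j, same_distribution (X i) (X j)) ->
  forall B, <<s cylinders >> B ->
    P [set w | B (fun i => X (s i) w)] = P [set w | B (fun i => X i w)].
Proof.
move=> indep same; apply: (@eq_law (fun i => X (s i)) X) => A mA.
have bigE (C : I -> set V) : [set w | forall i, C i (X i w)] =
    \bigcap_(i in [set` [set: I]%SET]) (X i @^-1` C i).
  apply/seteqP; split=> w /= h i; first by move=> _; exact: h.
  by apply: h; rewrite /= inE.
(* Asking [A i] of the sample [s i] for all i is asking [A (s^-1 j)] of the sample j for all j. *)
transitivity (P [set w | forall i, A ((s^-1)%g i) (X i w)]).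
  congr (P _); apply/seteqP; split=> w /= h i.
    by have := h ((s^-1)%g i); rewrite permKV.
  by have := h (s i); rewrite permK.
rewrite (bigE A) (bigE (fun i => A ((s^-1)%g i))).
rewrite (indep _ (fun i => A ((s^-1)%g i))); last by move=> i _; exact: mA.
rewrite indep; last by move=> i _; exact: mA.
rewrite [LHS](reindex_inj (@perm_inj _ s)) /=.
by apply: eq_big => i; rewrite ?inE // => _; rewrite permK; exact: same.
Qed.

End cylinders.

(** * From the pointwise count of outliers to a probability bound *)

Lemma sum_probability_le_card {d} {T : measurableType d} {R : realType}
    (P : probability T R) {k : nat} {E : 'I_k -> set T} {K : R} :
  (forall i, measurable (E i)) ->
  (forall w, #|[set i | w \in E i]%SET|%:R <= K) ->
  (\sum_(i < k) P (E i) <= K%:E)%E.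
Proof.
move=> mE leK.
(* The sum of the probabilities is the expected number of events that occur, which is at most [K] at
   every outcome. *)
have -> : (\sum_(i < k) P (E i) =
           \int[P]_w (\sum_(i < k) (\1_(E i) w)%:E))%E.
  rewrite ge0_integral_sum //.
  - by apply: eq_bigr => i _; rewrite integral_indic // setIT.
  - by move=> i; apply/measurable_EFinP; exact: measurable_indic.
rewrite -[leRHS]mule1 -(@probability_setT _ _ _ P) -integral_cst //.
apply: ge0_le_integral => //.
- by move=> w _; rewrite sume_ge0.
- apply: emeasurable_sum => i; apply/measurable_EFinP; exact: measurable_indic.
move=> w _; rewrite sumEFin lee_fin; apply: le_trans (leK w).
rewrite -sum1_card natr_sum [leRHS]big_mkcond /= ler_sum // => i _.
by rewrite inE indicE; case: (w \in E i).
Qed.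

(** A set of whole samples, so that exchangeability applies to it. Singular scatter matrices are
    excluded: there [invmx] is a default value and the distances need not sum to n. *)
Definition outlier {R : realType} {n N : nat} (t : R) (i : 'I_N) :
    set ('I_N -> 'cV[R]_n) :=
  [set x | (scatter x \in unitmx) &&
     (t <= mahalanobis_sq (scatter x) (empirical_mean x) (x i))].

Lemma outlier_perm {R : realType} {n N : nat} (t : R) (i : 'I_N)
    (s : {perm 'I_N}) (x : 'I_N -> 'cV[R]_n) :
  outlier t i (x \o s) = outlier t (s i) x.
Proof. by rewrite /outlier /= scatter_perm empirical_mean_perm. Qed.

(** The space [T] is left general: it serves both for the probability space and for the path space
    with its product sigma-algebra. *)
Lemma measurable_outlier d (T : measurableType d) (R : realType) (n N : nat)
    (t : R) (i : 'I_N) (x : T -> 'I_N -> 'cV[R]_n) :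
  (forall j, measurable_fun setT (x ^~ j)) ->
  measurable [set w | outlier t i (x w)].
Proof.
move=> mx.
have mxe j : measurable_mx (x ^~ j).
  by move=> k l; apply: (measurableT_comp (measurable_coord k l)); exact: mx.
rewrite -[X in measurable X]setTI; apply: measurable_and => //.
  by apply: measurable_unitmx; exact: measurable_scatter.
apply: measurable_fun_ler => //; apply: measurable_mahalanobis_sq => //.
  exact: measurable_scatter.
exact: measurable_empirical_mean.
Qed.

Lemma card_outlier {R : realType} {n N : nat} {t : R} (x : 'I_N -> 'cV[R]_n) :
  0 < t ->
  #|[set i | x \in outlier t i]%SET|%:R <= (Num.floor (n%:R / t))%:~R :> R.
Proof.
move=> t0; have [ux|nux] := boolP (scatter x \in unitmx).
  have := @card_mahalanobis_sq_ge _ _ _ _ _ ux t0.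
  rewrite -(ler_int R) -pmulrn; apply: le_trans.
  rewrite ler_nat subset_leq_card //; apply/fintype.subsetP => i.
  by rewrite !finset.inE => /set_mem /andP[].
(* For a singular scatter matrix no index is an outlier, and the bound need only be nonnegative. *)
rewrite (_ : [set i | _]%SET = finset.set0).
  by rewrite cards0 ler0z floor_ge0 divr_ge0 // ltW.
by apply/finset.setP => i; rewrite !finset.inE; apply/negP => /set_mem /andP[]; rewrite (negbTE nux).
Qed.

Lemma probability_outlier {R : realType} {n N : nat} {d} {T : measurableType d}
    {P : probability T R} {X : 'I_N.+1 -> {RV P >-> 'cV[R]_n}} {t : R} :
  mutually_independent X ->
  (forall i j, same_distribution (X i) (X j)) -> 0 < t ->
  (P [set w | outlier t ord_max (X ^~ w)] <=
    (N.+1%:R^-1 * (Num.floor (n%:R / t))%:~R)%:E)%E.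
Proof.
move=> indep same t0.
pose E i := [set w | outlier t i (X ^~ w)].
have mE i : measurable (E i).
  by apply: measurable_outlier => j; exact: measurable_funP.
have PE i : P (E i) = P (E ord_max).
  (* Swapping index i with the last one carries one event to the other, since mean and scatter are
     symmetric in the samples. *)
  rewrite /E; pose s := tperm i ord_max.
  (* On the path space the identity map has measurable coordinates, so [outlier] itself lies in the
     product sigma-algebra. *)
  have mB : <<s cylinders >> (@outlier R n N.+1 t ord_max).
    have mI := @measurable_eval _ 'cV[R]_n 'I_N.+1.
    pose C := g_sigma_algebraType (@cylinders _ 'cV[R]_n 'I_N.+1).
    exact: (@measurable_outlier _ C R n _ t ord_max (fun x => x) mI).
  rewrite -(@iid_exchangeable _ _ _ _ _ _ P X s indep same _ mB).
  congr (P _); apply/seteqP; split=> w /=;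
    by have := outlier_perm t ord_max s (X ^~ w); rewrite tpermR => <-.
have cardE w : #|[set i | w \in E i]%SET|%:R <= (Num.floor (n%:R / t))%:~R :> R.
  exact: card_outlier (X ^~ w) t0.
have := sum_probability_le_card P mE cardE.
have -> : (\sum_(i < N.+1) P (E i) = N.+1%:R%:E * P (E ord_max))%E.
  under eq_bigr do rewrite PE.
  by rewrite sumr_const card_ord mule_natl.
by rewrite EFinM lee_pdivlMl.
Qed.

Theorem theorem2p1 (R : realType) (n N : nat) (hn : (1 <= n)%N) (hN : (n <= N)%N)
    (d0 : measure_display) (T0 : measurableType d0) (P0 : probability T0 R)
    (xi : {RV P0 >-> 'cV[R]_n})
    (d : measure_display) (T : measurableType d) (P : probability T R)
    (X : 'I_N.+1 -> {RV P >-> 'cV[R]_n})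
    (hindep : mutually_independent X)
    (hdistr : forall i : 'I_N.+1, same_distribution (X i) xi)
    (hnonsing : {ae P, forall w : T,
       empirical_covariance (first_samples X w) \in unitmx})
    (lambda : R) (hlambda : 0 < lambda) :
  (P [set w : T |
       (lambda ^+ 2 <=
          mahalanobis_sq (empirical_covariance (first_samples X w))
                         (empirical_mean (first_samples X w))
                         (X ord_max w))%R]
   <= (Num.min 1
         (N.+1%:R^-1 *
          (Num.floor (n%:R * N.+1%:R * (N%:R ^+ 2 - 1 + N%:R * lambda ^+ 2)
                      / (N%:R ^+ 2 * lambda ^+ 2)))%:~R))%R%:E)%E.
Proof.
have mX i : measurable_mx (X i).
  move=> k l; apply: (measurableT_comp (measurable_coord k l)).
  exact: measurable_funP.
have my i : measurable_mx (fun w => first_samples X w i) by exact: mX.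
set Q := [set w | _]; have mQ : measurable Q.
  rewrite -[Q]setTI; apply: measurable_fun_le => //.
  apply: measurable_mahalanobis_sq => //.
    exact: measurable_empirical_covariance.
  exact: measurable_empirical_mean.
rewrite -/Q EFin_min le_min probability_le1 //=.
pose t : R := N%:R ^+ 2 * lambda ^+ 2
    / (N.+1%:R * (N%:R ^+ 2 - 1 + N%:R * lambda ^+ 2)).
have N1 : 1 <= N%:R :> R by rewrite ler1n (leq_trans hn).
have N0 : 0 < N%:R :> R by apply: lt_le_trans N1.
have l0 : 0 < lambda ^+ 2 by rewrite exprn_gt0.
have t0 : 0 < t.
  rewrite divr_gt0 ?mulr_gt0 ?exprn_gt0 //.
  (* Here N >= 1 gives N^2 - 1 >= 0, and the term N lambda^2 makes the sum positive. *)
  by rewrite ltr_wpDl ?mulr_gt0 // subr_ge0 exprn_ege1.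
rewrite (_ : _ / _ = n%:R / t); last by rewrite /t invf_div !mulrA.
apply: (le_trans _ (probability_outlier hindep _ t0)); last first.
  by move=> i j A mA; rewrite hdistr // hdistr.
(* The null set [Z] absorbs the outcomes with singular covariance; off [Z], a distance of at least
   lambda makes the last sample an outlier at level [t]. *)
have [Z [mZ PZ0 subZ]] := hnonsing.
have mE : measurable [set w | outlier t ord_max (X ^~ w)].
  by apply: measurable_outlier => j; exact: measurable_funP.
have /(le_measure P) : Q `<=` [set w | outlier t ord_max (X ^~ w)] `|` Z.
  move=> w Qw; have [uw|nuw] := pselect
    (empirical_covariance (first_samples X w) \in unitmx).
    (* By conversion [first_samples X w] is the path [X ^~ w] composed with [widen_ord]. *)
    left; have [ux le_t] :=
      @mahalanobis_sq_full_sample _ _ _ (X ^~ w) _ hn hlambda uw Qw.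
    by rewrite /= /outlier /= ux.
  by right; apply: subZ.
rewrite !inE => /(_ mQ (measurableU _ _ mE mZ)) /le_trans; apply.
apply: (le_trans (measureU2 _ mE mZ)).
by rewrite [X in (_ + X)%E]PZ0 adde0.
Qed.
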